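(* Let $H$ be a finite linear cycle set with abelian adjoint group, let $I$ be an abelian group with maps $\diamond,\prec$, and let $d_i,e_i,a_j,r_j$ be as in the context. Let $\gamma_1,\dots,\gamma_n\in I$, $\alpha:=\alpha_{\gamma_1,\dots,\gamma_n}$, $Y:=\{a_1,\dots,a_s\}$, $Z:=\{e_1,\dots,e_n\}$, and let $f_{11}\colon Y\times Z\to I$ be a map such that, for all $1\le i\le n$ and $1\le j\le s$, $$(a)\quad d_i f_{11}(a_j,e_i)+\sum_{k=1}^{d_i-1}\alpha\bigl(a_j\cdot e_i,k(a_j\cdot e_i)\bigr)-a_j\diamond\gamma_i=0 .$$ Let $f_1\colon Y\times H\to I$ be the map determined by $f_{11}$ (see context), put $\bar a_{j\ell}:=a_j^{\times(\ell+1)}-a_j$, and assume that $$(b)\quad F_1(a_j,a_k,e_i)=F_1(a_k,a_j,e_i)\qquad\text{for all } i,j,k,$$ where $$F_1(a_j,a_k,d):=f_1(a_k,a_j\cdot d)+a_k\diamond f_1(a_j,d)+\bigl(a_k\diamond f_1(a_j,{}^{a_j}a_k)\bigr)\prec\bigl((a_j\times a_k)\cdot d\bigr)-\bigl((a_j\times a_k)\diamond\alpha(a_j,{}^{a_j}a_k)\bigr)\prec\bigl((a_j\times a_k)\cdot d\bigr),$$ and that $$(c)\quad \sum_{\ell=0}^{r_j-1}a_j^{\times(r_j-1-\ell)}\diamond f_1(a_j,a_j^{\times\ell}\cdot e_i)+\sum_{\ell=1}^{r_j-1}\bigl(a_j^{\times\ell}\diamond f_1(a_j,\bar a_{j\ell})\bigr)\prec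 e_i-\sum_{\ell=1}^{r_j-1}\bigl(a_j^{\times(\ell+1)}\diamond\alpha(a_j,\bar a_{j\ell})\bigr)\prec e_i=0\qquad\text{for all } i,j.$$ Let $f\colon H\times H\to I$ be the map induced by the recursively defined map $f\colon \mathrm M_Y\times H\to I$ of the context. Then $(\alpha,-f)$ is a $2$-cocycle.
   Context: Linear cycle sets. A linear cycle set is an additive abelian group $H$ with a binary operation $\cdot$ such that each map $l\mapsto h\cdot l$ is bijective and $h\cdot(l+m)=h\cdot l+h\cdot m$, $(h+l)\cdot m=(h\cdot l)\cdot(h\cdot m)$ for all $h,l,m\in H$. The inverse of $l\mapsto h\cdot l$ is written $l\mapsto{}^hl$. Setting $h\times l:=h+{}^hl$ makes $H$ a group with neutral element $0$ (the adjoint group); $h^{\times k}$ denotes powers in this group. Actions. $I$ is an abelian group and $\diamond\colon H\times I\to I$, $\prec\colon I\times H\to I$ are maps such that, writing $y^h:=y-y\prec h$ and $y\triangleleft h:=h\diamond(y-y\prec h)$, for all $h,l\in H$ and $y,z\in I$: $y\triangleleft(h\times l)=(y\triangleleft h)\triangleleft l$, $(y+z)\triangleleft h=y\triangleleft h+z\triangleleft h$, $y\triangleleft 0=y$; $(l\times h)\diamond y=h\diamond(l\diamond y)$, $h\diamond(y+z)=h\diamond y+h\diamond z$, $0\diamond y=y$; $y^{h+l}+y=y^h+y^l$, $0^h=0$. Standing setting. As an additive group $H=\mathbb Z_{d_1}\oplus\cdots\oplus\mathbb Z_{d_n}$, and $e_i\in H$ is the element whose only non-zero coordinate is the $i$-th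 one, which equals $1$ (so $d_i\ge 2$). The group $(H,\times)$ is abelian and is the direct product of its cyclic subgroups generated by $a_1,\dots,a_s$; $r_j$ is the order of $a_j$ in $(H,\times)$. The map $\alpha$. For $\gamma_1,\dots,\gamma_n\in I$, $\alpha_{\gamma_1,\dots,\gamma_n}\colon H\times H\to I$ sends $(h,l)$ to $\sum_{i:\,h_i+l_i\ge d_i}\gamma_i$, where $h_i,l_i\in\{0,\dots,d_i-1\}$ represent the $i$-th coordinates of $h,l$. 2-cocycles. For $f\colon H\times H\to I$, the pair $(\alpha,-f)$ is a $2$-cocycle if $f(h,0)=f(0,h)=0$ for all $h$, and for all $h,l,m\in H$: $f(h,l+m)=f(h,l)+f(h,m)+\alpha(h\cdot l,h\cdot m)-h\diamond\alpha(l,m)$, and $f(h+l,m)=f(h\cdot l,h\cdot m)+(h\cdot l)\diamond f(h,m)+\bigl((h\cdot l)\diamond f(h,l)\bigr)\prec\bigl((h+l)\cdot m\bigr)-\bigl((h+l)\diamond\alpha(h,l)\bigr)\prec\bigl((h+l)\cdot m\bigr)$. The map $f_1$. Under (a) there is a unique map $f_1\colon Y\times H\to I$ with $f_1(a_j,e_i)=f_{11}(a_j,e_i)$ and $f_1(a_j,h+l)=f_1(a_j,h)+f_1(a_j,l)+\alpha(a_j\cdot h,a_j\cdot l)-a_j\diamond\alpha(h,l)$ for all $h,l\in H$. The map $f$. $\mathrm M_Y$ is the free magma on $Y$, with operation written $\times$; $\pi_Y\colon\mathrm M_Y\to(H,\times)$ is the canonical magma homomorphism, and an element $w\in\mathrm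 M_Y$ is also used to denote $\pi_Y(w)\in H$. The map $f\colon\mathrm M_Y\times H\to I$ is defined recursively by $f(a_j,d)=f_1(a_j,d)$ and, for $l,m\in\mathrm M_Y$, $d\in H$, $f(l\times m,d)=f(m,l\cdot d)+m\diamond f(l,d)+\bigl(m\diamond f(l,{}^lm)\bigr)\prec\bigl((l\times m)\cdot d\bigr)-\bigl((l\times m)\diamond\alpha(l,{}^lm)\bigr)\prec\bigl((l\times m)\cdot d\bigr)$. Under (a), (b), (c) the value $f(w,d)$ depends only on $(\pi_Y(w),d)$, so $f$ induces a map $H\times H\to I$, also denoted $f$. *)

(* Defs.v *)
From HB Require Import structures.
From mathcomp Require Import all_boot all_order all_algebra all_fingroup.
From mathcomp Require Import boolp classical_sets.

Set Implicit Arguments.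
Unset Strict Implicit.
Unset Printing Implicit Defensive.

Import GRing.Theory.
Local Open Scope ring_scope.

(* The direct sum of the Z/d_i.  As 'Z_m is Z/m only for m >= 2, this is used
   under the hypothesis that every d i is at least 2; the natural number
   underlying a coordinate h i is then its representative in {0, .., d i - 1}. *)
Definition Zsum (n : nat) (d : 'I_n -> nat) : Type :=
  {dffun forall i : 'I_n, 'Z_(d i)}.

Section ZsumZmodule.
Variables (n : nat) (d : 'I_n -> nat).

HB.instance Definition _ := Finite.copy (Zsum d) {dffun forall i : 'I_n, 'Z_(d i)}.

Definition Zsum_zero : Zsum d := [ffun i => 0 : 'Z_(d i)].
Definition Zsum_opp (h : Zsum d) : Zsum d := [ffun i => - h i].
Definition Zsum_add (h l : Zsum d) : Zsum d := [ffun i => h i + l i].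

Fact Zsum_addA : associative Zsum_add.
Proof. by move=> h l m; apply/ffunP=> i; rewrite !ffunE addrA. Qed.
Fact Zsum_addC : commutative Zsum_add.
Proof. by move=> h l; apply/ffunP=> i; rewrite !ffunE addrC. Qed.
Fact Zsum_add0 : left_id Zsum_zero Zsum_add.
Proof. by move=> h; apply/ffunP=> i; rewrite !ffunE add0r. Qed.
Fact Zsum_addN : left_inverse Zsum_zero Zsum_opp Zsum_add.
Proof. by move=> h; apply/ffunP=> i; rewrite !ffunE addNr. Qed.

HB.instance Definition _ := GRing.isZmodule.Build (Zsum d)
  Zsum_addA Zsum_addC Zsum_add0 Zsum_addN.

Lemma Zsum_addE (h l : Zsum d) i : (h + l) i = h i + l i.
Proof. exact: ffunE. Qed.

Definition Zsum_basis (i : 'I_n) : Zsum d := [ffun k => (k == i)%:R : 'Z_(d k)].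

Definition carry_cocycle (I : zmodType) (gamma : 'I_n -> I) (h l : Zsum d) : I :=
  \sum_(i < n | (d i <= h i + l i)%N) gamma i.

End ZsumZmodule.

Record linear_cycle_set (H : finZmodType) := LinearCycleSet {
  lcs_op :> H -> H -> H;
  lcs_bij : forall h, bijective (lcs_op h);
  lcs_addr : forall h l m, lcs_op h (l + m) = lcs_op h l + lcs_op h m;
  lcs_addl : forall h l m, lcs_op (h + l) m = lcs_op (lcs_op h l) (lcs_op h m)
}.

(* The carrier of H equipped with the adjoint group law
   h * l = h + lcs_inv L h l, whose identity element is 0. *)
Definition adjoint (H : finZmodType) (L : linear_cycle_set H) : Type := H.

Section Adjoint.
Variables (H : finZmodType) (L : linear_cycle_set H).

(* [finv] is the inverse of an injective self-map of a finite type. *)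
Definition lcs_inv (h l : H) : H := finv (L h) l.

Lemma lcs_invK h : cancel (lcs_inv h) (L h).
Proof. exact/f_finv/bij_inj/lcs_bij. Qed.

Lemma lcs_opK h : cancel (L h) (lcs_inv h).
Proof. exact/finv_f/bij_inj/lcs_bij. Qed.

Lemma lcs_inv_add h l m : lcs_inv h (l + m) = lcs_inv h l + lcs_inv h m.
Proof. by apply: (can_inj (lcs_opK h)); rewrite lcs_addr !lcs_invK. Qed.

Lemma lcs_op0 h : L h 0 = 0.
Proof. by apply: (addrI (L h 0)); rewrite -lcs_addr !addr0. Qed.

Lemma lcs_op0l l : L 0 l = l.
Proof.
apply: (can_inj (lcs_opK 0)).
by have := lcs_addl L 0 0 l; rewrite addr0 lcs_op0.
Qed.

HB.instance Definition _ := Finite.copy (adjoint L) H.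

Definition adjoint_mul (h l : adjoint L) : adjoint L := (h : H) + lcs_inv h l.
Definition adjoint_one : adjoint L := (0 : H).
Definition adjoint_inv (h : adjoint L) : adjoint L := L h (- (h : H)).

Lemma lcs_op_mul (h l : adjoint L) (m : H) :
  L (adjoint_mul h l) m = L l (L h m).
Proof. by rewrite /adjoint_mul lcs_addl lcs_invK. Qed.

Fact adjoint_mulA : associative adjoint_mul.
Proof.
move=> h l m; rewrite /adjoint_mul lcs_inv_add addrA; congr (_ + _).
apply: (can_inj (lcs_opK (adjoint_mul h l))).
by rewrite [RHS]lcs_invK lcs_op_mul !lcs_invK.
Qed.

Fact adjoint_mul1 : left_id adjoint_one adjoint_mul.
Proof.
by move=> l; rewrite /adjoint_mul /adjoint_one add0r -[RHS](lcs_invK 0) lcs_op0l.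
Qed.

Fact adjoint_mulVr : right_inverse adjoint_one adjoint_inv adjoint_mul.
Proof. by move=> h; rewrite /adjoint_mul /adjoint_inv lcs_opK subrr. Qed.

Fact adjoint_mulr1 : right_id adjoint_one adjoint_mul.
Proof.
move=> h; rewrite /adjoint_mul /adjoint_one.
by rewrite -[X in lcs_inv _ X](lcs_op0 h) lcs_opK addr0.
Qed.

Fact adjoint_mulV : left_inverse adjoint_one adjoint_inv adjoint_mul.
Proof.
move=> h; set k := adjoint_inv h.
have kV : adjoint_mul k (adjoint_inv k) = adjoint_one := adjoint_mulVr k.
rewrite -[adjoint_mul k h]adjoint_mulr1 -[X in adjoint_mul _ X]kV.
rewrite adjoint_mulA -(adjoint_mulA k h k) (adjoint_mulVr h).
by rewrite adjoint_mulr1.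
Qed.

HB.instance Definition _ := Finite_isGroup.Build (adjoint L)
  adjoint_mulA adjoint_mul1 adjoint_mulV.

End Adjoint.

Section Extension.
Variables (H : finZmodType) (L : linear_cycle_set H) (I : zmodType).
Variables (dia : H -> I -> I) (prec : I -> H -> I).

(* y ^ h and y <| h *)
Definition pow (y : I) (h : H) : I := y - prec y h.
Definition tri (y : I) (h : H) : I := dia h (pow y h).

Record is_lcs_action : Prop := IsLcsAction {
  tri_mul : forall y (h l : adjoint L), tri y (h * l)%g = tri (tri y h) l;
  tri_add : forall y z h, tri (y + z) h = tri y h + tri z h;
  tri_0 : forall y, tri y 0 = y;
  dia_mul : forall (l h : adjoint L) y, dia (l * h)%g y = dia h (dia l y);
  dia_add : forall h y z, dia h (y + z) = dia h y + dia h z;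
  dia_0 : forall y, dia 0 y = y;
  pow_add : forall y h l, pow y (h + l) + y = pow y h + pow y l;
  pow_0 : forall h, pow 0 h = 0
}.

(* The cocycle equations for a pair (alpha, beta) are expressed in terms of
   f := - beta. *)
Definition is_2cocycle (alpha beta : H -> H -> I) : Prop :=
  let f h l := - beta h l in
  [/\ forall h, f h 0 = 0 /\ f 0 h = 0,
      forall h l m, f h (l + m) =
        f h l + f h m + alpha (L h l) (L h m) - dia h (alpha l m)
    & forall h l m, f (h + l) m =
        f (L h l) (L h m) + dia (L h l) (f h m)
        + prec (dia (L h l) (f h l)) (L (h + l) m)
        - prec (dia (h + l) (alpha h l)) (L (h + l) m)].

Variable alpha : H -> H -> I.

(* The value at (l * m, x) computed from phi = f(l, -) and psi = f(m, -); this
   single expression gives both F_1 and the recursion on the free magma. *)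
Definition mul_step (l m : adjoint L) (phi psi : H -> I) (x : H) : I :=
  psi (L l x) + dia m (phi x)
  + prec (dia m (phi (lcs_inv L l m))) (L (l * m)%g x)
  - prec (dia (l * m)%g (alpha l (lcs_inv L l m))) (L (l * m)%g x).

(* Maps defined on Y = {a_0, .., a_(s-1)} or on Z = {e_0, .., e_(n-1)} are
   indexed by 'I_s and 'I_n respectively. *)
Variables (s n : nat) (a : 'I_s -> adjoint L) (e : 'I_n -> H).

Section F1.
Variable f11 : 'I_s -> 'I_n -> I.

Definition is_f1 (f1 : 'I_s -> H -> I) : Prop :=
  (forall j i, f1 j (e i) = f11 j i) /\
  (forall j h l, f1 j (h + l) =
     f1 j h + f1 j l + alpha (L (a j) h) (L (a j) l) - dia (a j) (alpha h l)).

(* Definite description: the map satisfying [is_f1] (and 0 if there is none). *)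
Definition f1_map : 'I_s -> H -> I :=
  xget (fun _ _ => 0) [set f1 : 'I_s -> H -> I | is_f1 f1]%classic.

End F1.

Inductive free_magma (Y : Type) : Type :=
  | magma_gen of Y
  | magma_op of free_magma Y & free_magma Y.

Fixpoint magma_eval (w : free_magma 'I_s) : adjoint L :=
  match w with
  | magma_gen j => a j
  | magma_op l m => (magma_eval l * magma_eval m)%g
  end.

Variable f1 : 'I_s -> H -> I.

Definition F1_map (j k : 'I_s) : H -> I := mul_step (a j) (a k) (f1 j) (f1 k).

Fixpoint magma_f (w : free_magma 'I_s) : H -> I :=
  match w with
  | magma_gen j => f1 j
  | magma_op l m =>
      mul_step (magma_eval l) (magma_eval m) (magma_f l) (magma_f m)
  end.

(* The map induced on H x H: the common value of magma_f w x over the words w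
   that evaluate to h.  The default 0 only matters when there is no such word,
   which happens only for s = 0. *)
Definition induced_f (h x : H) : I :=
  xget 0 [set y | exists2 w, magma_eval w = h & magma_f w x = y]%classic.

Definition abar (j : 'I_s) (l : nat) : H :=
  ((a j ^+ l.+1)%g : H) - (a j : H).

End Extension.

(* Main.v *)
(* For w in H call phi : H -> I twisted over w when (z, x) |-> (w \diamond z + phi x, w . x)
   is additive on the extension of H by I with cocycle alpha; for f(w, -) this is the first
   cocycle equation.  The second equation says that f(l * m, -) is obtained from f(l, -) and
   f(m, -) by the recursion on the free magma.  That recursion is an associative law on the
   pairs (w, phi) with phi twisted over w, so these form a monoid over the adjoint group.
   Condition (a) provides the pairs (a_j, f_1(a_j, -)), condition (b) makes them commute and
   condition (c) is (a_j, f_1(a_j, -))^r_j = 1.  As the adjoint group is the direct product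
   of the <a_j>, it follows that a_j |-> (a_j, f_1(a_j, -)) extends to a morphism, whose second
   component is f. *)
From HB Require Import structures.
Require Import Defs.
From mathcomp Require Import boolp classical_sets.
From mathcomp Require Import all_boot all_order all_algebra all_fingroup all_solvable.
From mathcomp Require Import zify.

Set Implicit Arguments.
Unset Strict Implicit.
Unset Printing Implicit Defensive.

Import GRing.Theory.
Local Open Scope ring_scope.

(** * Morphisms from a direct product of cyclic groups to a monoid *)

(** The image of [x] is read off from chosen exponents of [x] in the [a j]. As [M] is only a monoid,
    multiplicativity would merely make [p 1] idempotent, so [p 1 = 1] is claimed separately. *)
Lemma bigdprod_cycle_lift (gT : finGroupType) (M : monoidType) (s : nat)
    (a : 'I_s -> gT) (g : 'I_s -> M) (G : {group gT}) :
    (\big[dprod/1]_(j < s) <[a j]> = G)%g ->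
    (forall i j, commute (g i) (g j)) ->
    (forall j, g j ^+ #[a j] = 1)%g ->
  exists p : gT -> M, [/\ p 1%g = 1%g, forall j, p (a j) = g j
    & {in G &, {morph p : x y / (x * y)%g}}].
Proof.
move=> defG cgg gr.
have aG j : a j \in G.
  have /bigdprodW <- := defG; apply/prodsgP.
  exists (fun i => if i == j then a i else 1%g).
    by move=> i _; case: eqP => _; rewrite ?group1 ?cycle_id.
  by rewrite -big_mkcond big_pred1_eq.
(* In a direct product the factor [<[a i]>] centralises the product of the other factors, which
   contains [a j]. *)
have caa i j : commute (a i) (a j).
  have [-> // | neq] := eqVneq i j.
  have := defG; rewrite (bigD1 i) //= => /dprodP[[A B _ defB] _ cAB _].
  apply/commute_sym/(centsP cAB); last exact: cycle_id.
  rewrite defB -(bigdprodW defB); apply/prodsgP.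
  exists (fun k => if k == j then a k else 1%g).
    by move=> k _; case: eqP => _; rewrite ?group1 ?cycle_id.
  rewrite -big_mkcondr (big_pred1 j) // => k.
  by rewrite /= andbC; case: (eqVneq k j) => // ->; rewrite eq_sym neq.
(* Components in a direct product are unique, so the two exponents of [a j] agree modulo [#[a j]],
   and [gr] discards multiples of that order. *)
have wd (k k' : 'I_s -> nat) : (\prod_j a j ^+ k j = \prod_j a j ^+ k' j)%g ->
    (\prod_j g j ^+ k j = \prod_j g j ^+ k' j)%g.
  move=> eqk; apply: eq_bigr => j _.
  have kG : (\prod_j a j ^+ k j)%g \in G by apply: group_prod => i _; rewrite groupX.
  have [c [_ _ cU]] := mem_bigdprod defG kG.
  have Ek := cU (fun j => a j ^+ k j)%g (fun i _ => mem_cycle _ _) erefl j isT.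
  have Ek' := cU (fun j => a j ^+ k' j)%g (fun i _ => mem_cycle _ _) eqk j isT.
  have /eqP : (a j ^+ k j = a j ^+ k' j)%g by rewrite Ek Ek'.
  rewrite eq_expg_mod_order => /eqP kk.
  by rewrite (divn_eq (k j) #[a j]%g) (divn_eq (k' j) #[a j]%g) kk !expgnDr
             ![(_ * #[_]%g)%N]mulnC !expgnA gr !expg1n.
have /choice[k kE] : forall x, exists k : 'I_s -> nat,
    x \in G -> x = (\prod_j a j ^+ k j)%g.
  move=> x; case: (boolP (x \in G)) => [xG|_]; last by exists (fun=> 0%N).
  have [c [cG -> _]] := mem_bigdprod defG xG.
  have /choice[k kE] : forall j, exists k, c j = (a j ^+ k)%g.
    by move=> j; have /cycleP := cG j isT.
  by exists k => _; apply: eq_bigr.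
(* The chosen [k x] may be replaced by any exponents representing [x]: zero for the identity, the
   indicator of [j] for [a j], and [k x + k y] for a product. *)
have pE x l : x = (\prod_j a j ^+ l j)%g ->
    (\prod_j g j ^+ k x j = \prod_j g j ^+ l j)%g.
  move=> xE; apply: wd; rewrite -kE // xE.
  by apply: group_prod => i _; rewrite groupX.
exists (fun x => \prod_j g j ^+ k x j)%g; split.
- rewrite (pE _ (fun=> 0%N)); first by rewrite big1.
  by rewrite big1.
- move=> j; rewrite (pE _ (fun i => i == j : nat)).
    transitivity (\prod_(i | i == j) g i)%g; last exact: big_pred1_eq.
    rewrite [RHS] big_mkcond.
    by apply: eq_bigr => i _; case: eqP.
  transitivity (\prod_(i | i == j) a i)%g; first by rewrite big_pred1_eq.
  rewrite [LHS] big_mkcond.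
  by apply: eq_bigr => i _; case: eqP.
- move=> x y xG yG; rewrite (pE _ (fun i => k x i + k y i)%N).
    under eq_bigr do rewrite expgnDr.
    apply: prodgM_commute => i j _ _; exact/commuteX2/cgg.
  under eq_bigr do rewrite expgnDr.
  rewrite [in LHS](kE x xG) [in LHS](kE y yG); symmetry.
  apply: prodgM_commute => i j _ _; exact/commuteX2/caa.
Qed.

(** * Abelian extensions defined by normalised symmetric cocycles *)

Record sym_cocycle (H I : zmodType) := SymCocycle {
  sym_cocycle_fun :> H -> H -> I;
  sym_cocycle0 : forall h, sym_cocycle_fun 0 h = 0;
  sym_cocycleC : forall h l, sym_cocycle_fun h l = sym_cocycle_fun l h;
  sym_cocycleA : forall h l m,
    sym_cocycle_fun l m + sym_cocycle_fun h (l + m) =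
    sym_cocycle_fun h l + sym_cocycle_fun (h + l) m
}.

Lemma sym_cocycle0r (H I : zmodType) (c : sym_cocycle H I) h : c h 0 = 0.
Proof. by rewrite sym_cocycleC sym_cocycle0. Qed.

(** A separate name for the pairs, whose addition is deformed by [c] and so differs from the
    componentwise one. *)
Definition extension (H I : zmodType) (c : sym_cocycle H I) : Type := (I * H)%type.

Section ExtensionZmodule.
Variables (H I : zmodType) (c : sym_cocycle H I).

HB.instance Definition _ := Choice.copy (extension c) (I * H)%type.

Definition ext_zero : extension c := (0, 0).
Definition ext_opp (u : extension c) : extension c := (- u.1 - c (- u.2) u.2, - u.2).
Definition ext_add (u v : extension c) : extension c :=
  (u.1 + v.1 + c u.2 v.2, u.2 + v.2).

Fact ext_addA : associative ext_add.
Proof.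
move=> [x h] [y l] [z m]; rewrite /ext_add /=; congr (_, _); last exact: addrA.
rewrite -!addrA; congr (_ + (_ + _)).
by rewrite sym_cocycleA [RHS]addrCA.
Qed.

Fact ext_addC : commutative ext_add.
Proof. by move=> u v; rewrite /ext_add [u.1 + _]addrC [u.2 + _]addrC sym_cocycleC. Qed.

Fact ext_add0 : left_id ext_zero ext_add.
Proof. by move=> [x h]; rewrite /ext_add /= sym_cocycle0 !add0r addr0. Qed.

Fact ext_addN : left_inverse ext_zero ext_opp ext_add.
Proof.
move=> [x h]; rewrite /ext_add /ext_opp /= addNr; congr (_, _).
by rewrite addrAC subrK addNr.
Qed.

HB.instance Definition _ := GRing.isZmodule.Build (extension c)
  ext_addA ext_addC ext_add0 ext_addN.

Lemma ext_addE (u v : extension c) : u + v = (u.1 + v.1 + c u.2 v.2, u.2 + v.2).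
Proof. by []. Qed.

(** This produces the sum over multiples that occurs in condition (a). *)
Lemma ext_mulrn (u : extension c) k :
  u *+ k.+1 = (u.1 *+ k.+1 + \sum_(1 <= j < k.+1) c u.2 (u.2 *+ j), u.2 *+ k.+1).
Proof.
elim: k => [|k IHk]; first by rewrite big_geq // addr0; case: u.
rewrite mulrS IHk ext_addE /= [in RHS]big_nat_recr //= !mulrS.
by rewrite !addrA.
Qed.

Lemma ext_sum2 (J : Type) (s : seq J) (P : pred J) (F : J -> extension c) :
  (\sum_(j <- s | P j) F j).2 = \sum_(j <- s | P j) (F j).2.
Proof. by apply: (big_morph (fun u : extension c => u.2)). Qed.

Definition ext_inj (x : I) : extension c := (x, 0).

Lemma ext_injD x y : ext_inj (x + y) = ext_inj x + ext_inj y.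
Proof. by rewrite ext_addE /= sym_cocycle0 !addr0. Qed.

End ExtensionZmodule.

(** * Carries form a symmetric cocycle *)

(** Both sides count how often [d] is removed when [a + b + c] is reduced modulo [d]. *)
Lemma carry_addn (d a b c : nat) :
  (a < d -> b < d -> c < d ->
  (d <= b + c) + (d <= a + (b + c) %% d) =
  (d <= a + b) + (d <= (a + b) %% d + c))%N.
Proof.
move=> ad bd cd.
have modE x y : (x < d -> y < d -> (x + y) %% d = x + y - d * (d <= x + y))%N.
  move=> xd yd; case: leqP => xy; last by rewrite muln0 subn0 modn_small.
  by rewrite muln1 -{1}(subnK xy) modnDr modn_small //; lia.
rewrite !modE //; do ![case: leqP => ?]; lia.
Qed.

Section Carry.
Variables (n : nat) (d : 'I_n -> nat) (d_ge2 : forall i, (2 <= d i)%N).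

Lemma Zsum_lt (h : Zsum d) i : (h i < d i)%N.
Proof. by rewrite -{2}(Zp_cast (d_ge2 i)). Qed.

Lemma Zsum_addn (h l : Zsum d) i : ((h + l)%R i = (h i + l i) %% d i :> nat)%N.
Proof. by rewrite Zsum_addE /=; congr (_ %% _)%N; apply: Zp_cast. Qed.

Lemma Zsum_addn_carry (h l : Zsum d) i :
  (h i + l i = (h + l)%R i + d i * (d i <= h i + l i))%N.
Proof.
rewrite Zsum_addn; have := Zsum_lt h i; have := Zsum_lt l i.
move=> li hi; case: leqP => hl; last by rewrite muln0 addn0 modn_small.
by rewrite muln1 -{2}(subnK hl) modnDr modn_small; lia.
Qed.

Lemma Zsum_basisn i k : (Zsum_basis d i k = (k == i) :> nat)%N.
Proof.
rewrite ffunE val_Zp_nat // ?modn_small //; case: eqP => //= _; exact: ltnW.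
Qed.

Lemma Zsum_sumE (J : Type) (s : seq J) (P : pred J) (F : J -> Zsum d) k :
  (\sum_(j <- s | P j) F j) k = \sum_(j <- s | P j) F j k.
Proof. by apply: (big_morph (fun u : Zsum d => u k)) => [x y|]; rewrite ffunE. Qed.

Lemma Zsum_mulrnE (u : Zsum d) m k : (u *+ m) k = u k *+ m.
Proof. by elim: m => [|m IH]; rewrite ?ffunE // !mulrS Zsum_addE IH. Qed.

Lemma Zsum_basis_order i : Zsum_basis d i *+ d i = 0.
Proof.
apply/ffunP => k; rewrite Zsum_mulrnE !ffunE -mulrnA.
by case: eqP => [->|_]; rewrite ?mul0n // mul1n pchar_Zp.
Qed.

Lemma Zsum_decomp (h : Zsum d) : h = \sum_i Zsum_basis d i *+ h i.
Proof.
apply/ffunP => k; rewrite Zsum_sumE (bigD1 k) //= big1 => [|i ik].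
  by rewrite Zsum_mulrnE ffunE eqxx addr0 natr_Zp.
by rewrite Zsum_mulrnE ffunE eq_sym (negPf ik) mul0rn.
Qed.

Variables (I : zmodType) (gamma : 'I_n -> I).

Fact carry_cocycle0 h : carry_cocycle gamma (0 : Zsum d) h = 0.
Proof.
rewrite /carry_cocycle big_pred0 // => i.
by rewrite ffunE /= add0n leqNgt Zsum_lt.
Qed.

Fact carry_cocycleC (h l : Zsum d) : carry_cocycle gamma h l = carry_cocycle gamma l h.
Proof. by apply: eq_bigl => i; rewrite addnC. Qed.

Lemma carry_cocycleE (h l : Zsum d) :
  carry_cocycle gamma h l = \sum_i gamma i *+ (d i <= h i + l i)%N.
Proof. by rewrite /carry_cocycle big_mkcond; apply: eq_bigr => i _; case: leqP. Qed.

Fact carry_cocycleA (h l m : Zsum d) :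
  carry_cocycle gamma l m + carry_cocycle gamma h (l + m) =
  carry_cocycle gamma h l + carry_cocycle gamma (h + l) m.
Proof.
rewrite !carry_cocycleE -!big_split; apply: eq_bigr => i _ /=.
by rewrite -!mulrnDr !Zsum_addn carry_addn ?Zsum_lt.
Qed.

Definition carry_sym_cocycle : sym_cocycle (Zsum d) I :=
  SymCocycle carry_cocycle0 carry_cocycleC carry_cocycleA.

End Carry.

(** * Twisted maps and their associative law *)

Section Twisted.
Variables (H : finZmodType) (L : linear_cycle_set H) (I : zmodType).
Variables (dia : H -> I -> I) (prec : I -> H -> I).
Hypothesis act : is_lcs_action L dia prec.
Variable c : sym_cocycle H I.

Lemma lcs_opMn h l k : L h (l *+ k) = L h l *+ k.
Proof. by elim: k => [|k IHk]; rewrite ?lcs_op0 // !mulrS lcs_addr IHk. Qed.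

Lemma lcs_op1 (x : H) : L (1%g : adjoint L) x = x. Proof. exact: lcs_op0l. Qed.

Lemma lcs_opM (h l : adjoint L) (x : H) : L (h * l)%g x = L l (L h x).
Proof. exact: lcs_op_mul. Qed.

Lemma lcs_invM (h l : adjoint L) (x : H) :
  lcs_inv L (h * l)%g x = lcs_inv L h (lcs_inv L l x).
Proof. by apply: (can_inj (lcs_opK L (h * l)%g)); rewrite [RHS]lcs_opM !lcs_invK. Qed.

(** Every sum is thus an adjoint product, which turns the second cocycle equation into a formula for
    products. *)
Lemma lcs_mulE (h l : H) : ((h : adjoint L) * (L h l : adjoint L))%g = h + l :> H.
Proof. by rewrite /mulg /= /adjoint_mul lcs_opK. Qed.

Lemma mul_step_op (al : H -> H -> I) (h l : H) phi psi x :
  mul_step dia prec al (h : adjoint L) (L h l) phi psi x =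
  psi (L h x) + dia (L h l) (phi x)
  + prec (dia (L h l) (phi l)) (L (h + l) x)
  - prec (dia (h + l) (al h l)) (L (h + l) x).
Proof. by rewrite /mul_step lcs_opK lcs_mulE. Qed.

Lemma dia0r h : dia h 0 = 0.
Proof. by apply: (addrI (dia h 0)); rewrite -(dia_add act) !addr0. Qed.

Lemma diaN h y : dia h (- y) = - dia h y.
Proof. by apply: (addrI (dia h y)); rewrite -(dia_add act) !subrr dia0r. Qed.

Lemma diaB h y z : dia h (y - z) = dia h y - dia h z.
Proof. by rewrite (dia_add act) diaN. Qed.

Lemma dia1 y : dia (1%g : adjoint L) y = y. Proof. exact: (dia_0 act). Qed.

Lemma dia_inj h : injective (dia h).
Proof.
move=> y z /(congr1 (dia (h : adjoint L)^-1%g)).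
by rewrite -!(dia_mul act) mulgV !dia1.
Qed.

Lemma precDl y z h : prec (y + z) h = prec y h + prec z h.
Proof.
have := tri_add act y z h; rewrite /tri /pow -(dia_add act) => /dia_inj.
by rewrite addrACA -opprD => /addrI/oppr_inj.
Qed.

Lemma precDr y h l : prec y (h + l) = prec y h + prec y l.
Proof.
have := pow_add act y h l; rewrite /pow addrAC addrACA -opprD => /addrI.
exact: oppr_inj.
Qed.

Lemma prec0l h : prec 0 h = 0.
Proof. by have := pow_0 act h; rewrite /pow add0r => /eqP; rewrite oppr_eq0 => /eqP. Qed.

Lemma precNl y h : prec (- y) h = - prec y h.
Proof. by apply: (addrI (prec y h)); rewrite -precDl !subrr prec0l. Qed.

(** This is [tri_mul] for the product of [h] and [L h l], which equals [h + l], after cancelling the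
    injective [dia (L h l)]. *)
Lemma dia_prec y h l : dia h (prec y l) = prec (dia h (y - prec y h)) (L h l).
Proof.
have := tri_mul act y h (L h l); rewrite /tri /pow lcs_mulE.
have -> z : dia (h + l) z = dia (L h l) (dia h z).
  by rewrite -(dia_mul act) lcs_mulE.
by move=> /dia_inj; rewrite precDr opprD addrA diaB => /addrI /oppr_inj.
Qed.

Definition twisted (w : H) (phi : H -> I) : Prop :=
  forall h l, phi (h + l) = phi h + phi l + c (L w h) (L w l) - dia w (c h l).

Lemma twisted0 w phi : twisted w phi -> phi 0 = 0.
Proof.
move=> /(_ 0 0); rewrite lcs_op0 !addr0 sym_cocycle0 dia0r subr0 addr0.
by move=> /(canLR (addrK _)); rewrite subrr.
Qed.

(** The inhomogeneous terms depend only on [w] and [c], so they cancel in the difference. *)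
Lemma twisted_eq w phi psi : twisted w phi -> twisted w psi ->
  exists2 delta : H -> I, {morph delta : x y / x + y}
    & forall x, phi x = psi x + delta x.
Proof.
move=> Tphi Tpsi; exists (fun x => phi x - psi x) => [x y|x].
  2: by rewrite addrC subrK.
rewrite Tphi Tpsi !opprD opprK !addrA.
by rewrite [LHS](ACl (1*5*2*6*(3*7)*(4*8))) /= subrr addNr !addr0.
Qed.

(** The term [dia m (c (L l x) (L l y))] arises from [phi] and from [psi] with opposite signs, and
    the [prec] terms are additive in [x]. *)
Lemma twisted_mul_step (l m : adjoint L) phi psi :
  twisted l phi -> twisted m psi ->
  twisted (l * m)%g (mul_step dia prec c l m phi psi).
Proof.
move=> Tphi Tpsi x y; rewrite /mul_step !lcs_opM !lcs_addr Tphi Tpsi.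
rewrite !precDr diaB !(dia_add act) (dia_mul act l m (c x y)) !opprD !addrA.
by rewrite [LHS](ACl (1*5*9*11*2*6*10*12*3*8*(4*7))) /= addNr addr0.
Qed.


Lemma mul_stepA (l m p : adjoint L) phi psi chi :
  twisted l phi ->
  mul_step dia prec c l (m * p)%g phi (mul_step dia prec c m p psi chi) =1
  mul_step dia prec c (l * m)%g p (mul_step dia prec c l m phi psi) chi.
Proof.
move=> Tphi x; rewrite /mul_step !lcs_opM mulgA lcs_invM !(lcs_invK, lcs_opK).
set X := L p (L m (L l x)); set q := (l * m * p)%g.
have -> : lcs_inv L l (m * p)%g = lcs_inv L l m + lcs_inv L l (lcs_inv L m p).
  by rewrite -lcs_inv_add.
rewrite Tphi !lcs_invK.
set A := lcs_inv L l m; set C := lcs_inv L m p; set B := lcs_inv L l C.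
(* Since [l + A] is [l * m], this is the cocycle identity. The term in [c A B] will cancel the one
   coming from the expansion of [phi (A + B)]. *)
have -> : c l (A + B) = c l A + c (l * m)%g B - c A B.
  by rewrite -sym_cocycleA [RHS]addrC addKr.
have diaMp y : dia (m * p)%g y = dia p (dia m y) := dia_mul act m p y.
have diaq y : dia q y = dia p (dia (l * m)%g y) := dia_mul act _ p y.
have diaql y : dia p (dia m (dia l y)) = dia q y.
  by rewrite diaq (dia_mul act l m).
(* Only the outer [prec] terms are moved past [dia p]. The nested ones this creates on the right
   cancel those obtained by evaluating the inner [mul_step] at [lcs_inv L (l * m) p]. *)
rewrite !(dia_add act, diaN) !(dia_prec _ p (L m (L l x))) -/X.
rewrite !(dia_add act, diaN) !(precDl, precNl) !(diaMp, diaql) -!diaq.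
rewrite !opprD !opprK !addrA.
rewrite [LHS](ACl (1*2*5*6*10*3*7*11*(4*8)*(9*12))) /= !addNr !addr0.
by rewrite [RHS](ACl (1*2*3*4*6*8*9*12*(5*10)*(7*11))) /= addNr subrr !addr0.
Qed.

Lemma twisted1 : twisted (1%g : adjoint L) (fun=> 0).
Proof. by move=> h l; rewrite !lcs_op1 dia1 !add0r subrr. Qed.

Lemma mul_step1l (m : adjoint L) psi :
  mul_step dia prec c 1%g m (fun=> 0) psi =1 psi.
Proof.
by move=> x; rewrite /mul_step lcs_op1 sym_cocycle0 !dia0r !prec0l subr0 !addr0.
Qed.

Lemma mul_step1r (l : adjoint L) phi : twisted l phi ->
  mul_step dia prec c l 1%g phi (fun=> 0) =1 phi.
Proof.
move=> Tphi x; rewrite /mul_step !dia1.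
have -> : lcs_inv L l (1%g : adjoint L) = 0.
  by apply: (can_inj (lcs_opK L l)); rewrite lcs_invK lcs_op0.
by rewrite (twisted0 Tphi) sym_cocycle0r dia0r !prec0l subr0 addr0 add0r.
Qed.

Record twisted_pair := TwistedPair {
  tp_base : adjoint L;
  tp_map : H -> I;
  tp_mapP : twisted tp_base tp_map
}.

Lemma tp_eq u v : tp_base u = tp_base v -> tp_map u =1 tp_map v -> u = v.
Proof.
case: u v => [w phi Tphi] [w' psi Tpsi] /= ew /funext ephi.
by case: _ / ew Tpsi; case: _ / ephi => Tpsi; congr TwistedPair; exact: Prop_irrelevance.
Qed.

HB.instance Definition _ := gen_eqMixin twisted_pair.
HB.instance Definition _ := gen_choiceMixin twisted_pair.

Definition tp_one := TwistedPair twisted1.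
Definition tp_mul u v := TwistedPair (twisted_mul_step (tp_mapP u) (tp_mapP v)).

Fact tp_mulA : associative tp_mul.
Proof. by move=> u v w; apply: tp_eq; [exact: mulgA | exact/mul_stepA/tp_mapP]. Qed.

Fact tp_mul1 : left_id tp_one tp_mul.
Proof. by move=> u; apply: tp_eq; [exact: mul1g | exact: mul_step1l]. Qed.

Fact tp_mulr1 : right_id tp_one tp_mul.
Proof. by move=> u; apply: tp_eq; [exact: mulg1 | exact/mul_step1r/tp_mapP]. Qed.

End Twisted.

(* The law of the monoid depends on the action axioms, so the carrier is given
   them as a parameter. *)
Definition tp_monoid H (L : linear_cycle_set H) I dia prec
    (act : is_lcs_action L dia prec) (c : sym_cocycle H I) : Type :=
  twisted_pair L dia c.

(** * Powers in the monoid of twisted pairs *)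

Section TwistedMonoid.
Variables (H : finZmodType) (L : linear_cycle_set H) (I : zmodType).
Variables (dia : H -> I -> I) (prec : I -> H -> I).
Variables (act : is_lcs_action L dia prec) (c : sym_cocycle H I).

HB.instance Definition _ := Choice.copy (tp_monoid act c) (twisted_pair L dia c).
HB.instance Definition _ := isMonoid.Build (tp_monoid act c)
  (tp_mulA act (c := c)) (tp_mul1 act (c := c)) (tp_mulr1 act (c := c)).

Lemma tp_baseX (u : tp_monoid act c) k : tp_base (u ^+ k)%g = (tp_base u ^+ k)%g.
Proof. by elim: k => // k IHk; rewrite !expgS -IHk. Qed.

(** For [u = (a_j, f_1(a_j, -))] and [k = r_j] the right side becomes the left side of condition
    (c), as [w ^+ k] is then the identity. *)
Lemma tp_mapX (u : tp_monoid act c) k x :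
  let w := tp_base u in let phi := tp_map u in
  tp_map (u ^+ k)%g x =
    \sum_(0 <= l < k) dia (w ^+ (k - 1 - l))%g (phi (L (w ^+ l)%g x))
    + \sum_(1 <= l < k) prec (dia (w ^+ l)%g (phi (lcs_inv L w (w ^+ l)%g)))
        (L (w ^+ k)%g x)
    - \sum_(1 <= l < k) prec (dia (w ^+ l.+1)%g (c w (lcs_inv L w (w ^+ l)%g)))
        (L (w ^+ k)%g x).
Proof.
move=> w phi.
have inv1 : lcs_inv L w (1%g : adjoint L) = 0.
  by apply: (can_inj (lcs_opK L w)); rewrite lcs_invK lcs_op0.
(* The [prec] terms of index 0 vanish. Including them makes the induction step uniform, also from
   [k = 0] to [k = 1]. *)
have from0 (F : nat -> I) : F 0 = 0 -> \sum_(1 <= l < k) F l = \sum_(0 <= l < k) F l.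
  by case: k => [|k] F0; [rewrite !big_geq | rewrite [RHS]big_ltn // F0 add0r].
rewrite !from0; first last.
- by rewrite inv1 [phi 0](twisted0 act (tp_mapP u)) (dia0r act) (prec0l act).
- by rewrite inv1 sym_cocycle0r (dia0r act) (prec0l act).
clear from0; elim: k x => [|k IHk] x.
  by rewrite !big_geq // addr0 subr0.
transitivity (mul_step dia prec c w (w ^+ k)%g phi (tp_map (u ^+ k)%g) x).
  by rewrite expgS -tp_baseX.
rewrite /mul_step IHk -expgS.
(* Multiplication by [u] on the left creates the [dia] term of index 0 and shifts the others,
   whereas the new [prec] terms have the top index [k]. *)
rewrite [\sum_(0 <= l < k.+1) dia _ _]big_nat_recl //.
rewrite ![\sum_(0 <= l < k.+1) prec _ _]big_nat_recr //=.
rewrite !expgS !lcs_opM !subSS !subn0.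
rewrite expg0 lcs_op1 !opprD !addrA [LHS](ACl (4*1*2*5*3*6)) /=.
do 5![congr (_ + _)]; apply: eq_bigr => l _.
by rewrite -lcs_opM -expgS -subnDA add1n.
Qed.

End TwistedMonoid.

(** * Existence and uniqueness of twisted maps with prescribed values on the basis *)

Section Generators.
Variables (n : nat) (d : 'I_n -> nat) (d_ge2 : forall i, (2 <= d i)%N).
Variables (L : linear_cycle_set (Zsum d)) (I : zmodType).
Variables (dia : Zsum d -> I -> I) (prec : I -> Zsum d -> I).
Hypothesis act : is_lcs_action L dia prec.
Variable gamma : 'I_n -> I.

Let c := carry_sym_cocycle d_ge2 gamma.
Let e := @Zsum_basis n d.

(** The hypothesis, condition (a) over an arbitrary [w], says that [d i] copies of the lift [T i] of
    [L w (e i)] add up to [dia w (gamma i)]. Hence the linear combinations [S h] of these lifts are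
    additive up to carries, and their first component is the required map. *)
Lemma twisted_exists w (x : 'I_n -> I) :
    (forall i, x i *+ d i + \sum_(1 <= k < d i) c (L w (e i)) (L w (e i) *+ k)
               = dia w (gamma i)) ->
  exists2 phi, twisted L dia c w phi & forall i, phi (e i) = x i.
Proof.
move=> xd; pose T i : extension c := (x i, L w (e i)).
pose S (h : Zsum d) := \sum_i T i *+ h i.
have S2 h : (S h).2 = L w h.
  rewrite ext_sum2 {2}(Zsum_decomp h) (big_morph _ (lcs_addr L w) (lcs_op0 L w)).
  apply: eq_bigr => i _; rewrite lcs_opMn.
  by case: (nat_of_ord _) => // k; rewrite ext_mulrn.
have Td i : T i *+ d i = ext_inj c (dia w (gamma i)).
  have := d_ge2 i; case di: (d i) => [|k] // _.
  by rewrite ext_mulrn -di xd /= -lcs_opMn Zsum_basis_order // lcs_op0.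
(* A carry in coordinate [i] trades [d i] copies of [T i] for one [dia w (gamma i)]. *)
have SD h l : S h + S l = S (h + l) + ext_inj c (dia w (c h l)).
  rewrite [c h l]carry_cocycleE.
  rewrite (big_morph _ (dia_add act w) (dia0r act w)).
  rewrite (big_morph _ (ext_injD c) (erefl _)) -!big_split.
  apply: eq_bigr => i _ /=; rewrite -mulrnDr [in LHS](Zsum_addn_carry d_ge2).
  rewrite mulrnDr mulrnA Td.
  by congr (_ + _); case: leqP => _ //; rewrite !mulr0n (dia0r act).
exists (fun h => (S h).1) => [h l|i].
  have : (S h).1 + (S l).1 + c (S h).2 (S l).2
       = (S (h + l)).1 + dia w (c h l) + c (S (h + l)).2 0.
    by have := congr1 (fun u : extension c => u.1) (SD h l); rewrite !ext_addE.
  by rewrite !S2 => ->; rewrite sym_cocycle0r addr0 addrK.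
rewrite /S (bigD1 i) // big1 => [|k ki]; rewrite Zsum_basisn ?d_ge2 //.
  by rewrite eqxx [X in X.1](addr0 (T i)).
by rewrite (negPf ki).
Qed.

(** The difference is additive and vanishes on the generators [e i]. *)
Lemma twisted_ext w phi psi : twisted L dia c w phi -> twisted L dia c w psi ->
  (forall i, phi (e i) = psi (e i)) -> phi =1 psi.
Proof.
move=> Tphi Tpsi eq_e h; have [delta deltaD phiE] := twisted_eq Tphi Tpsi.
have delta0 : delta 0 = 0 by apply: (addrI (delta 0)); rewrite -deltaD !addr0.
have deltaMn x k : delta (x *+ k) = delta x *+ k.
  by elim: k => // k IHk; rewrite !mulrS deltaD IHk.
rewrite phiE (Zsum_decomp h) (big_morph _ deltaD delta0) [X in _ + X]big1 ?addr0 //.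
move=> i _; rewrite deltaMn.
suff -> : delta (Zsum_basis d i) = 0 by rewrite mul0rn.
by apply: (addrI (psi (e i))); rewrite -phiE addr0.
Qed.

End Generators.

(** * Words in the generators and the induced map *)

(** The free magma has no empty word, so the identity is a separate case; for [s = 0] there is no
    word at all. *)
Lemma dprod_cycle_magma_eval (H : finZmodType) (L : linear_cycle_set H) (s : nat)
    (a : 'I_s -> adjoint L) :
    \big[dprod/1%g]_(j < s) <[a j]>%g = [set: adjoint L] ->
  forall h : adjoint L, h = 1%g \/ exists w, magma_eval a w = h.
Proof.
move=> dirL h; have [c [ca -> _]] := mem_bigdprod dirL (in_setT h).
apply: (big_ind (fun x => x = 1%g \/ exists w, magma_eval a w = x)); first by left.
  move=> x y [-> | [v <-]] [-> | [w <-]]; rewrite ?mul1g ?mulg1;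
    try by [left | right; eexists].
  by right; exists (magma_op v w).
move=> j _; have /cycleP[k ->] := ca j isT.
case: k => [|k]; [by left | right].
elim: k => [|k [w wE]]; first by exists (magma_gen j).
by exists (magma_op (magma_gen j) w); rewrite /= wE -expgS.
Qed.

Theorem theorem2p33
  (n s : nat) (d : 'I_n -> nat) (d_ge2 : forall i, (2 <= d i)%N)
  (L : linear_cycle_set (Zsum d))
  (I : zmodType) (dia : Zsum d -> I -> I) (prec : I -> Zsum d -> I)
  (act : is_lcs_action L dia prec)
  (abL : abelian [set: adjoint L])
  (a : 'I_s -> adjoint L)
  (dirL : \big[dprod/1%g]_(j < s) <[a j]>%g = [set: adjoint L])
  (gamma : 'I_n -> I) (f11 : 'I_s -> 'I_n -> I) :
  let e := @Zsum_basis n d in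
  let r := fun j : 'I_s => #[a j]%g in
  let alpha := carry_cocycle gamma in
  let f1 := f1_map dia alpha a e f11 in
  let F1 := F1_map dia prec alpha a f1 in
  let f := induced_f dia prec alpha a f1 in
  (forall i j,
     f11 j i *+ d i
     + \sum_(1 <= k < d i) alpha (L (a j) (e i)) (L (a j) (e i) *+ k)
     - dia (a j) (gamma i) = 0) ->
  (forall i j k, F1 j k (e i) = F1 k j (e i)) ->
  (forall i j,
     \sum_(0 <= l < r j)
        dia (a j ^+ (r j - 1 - l))%g (f1 j (L (a j ^+ l)%g (e i)))
     + \sum_(1 <= l < r j)
        prec (dia (a j ^+ l)%g (f1 j (abar a j l))) (e i)
     - \sum_(1 <= l < r j)
        prec (dia (a j ^+ l.+1)%g (alpha (a j) (abar a j l))) (e i) = 0) ->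
  is_2cocycle L dia prec alpha (fun h l => - f h l).
Proof.
move=> e r alpha f1 F1 f Ha Hb Hc.
pose c := carry_sym_cocycle d_ge2 gamma.
(* A map selected by [xget] has the required property once some map does; condition (a) yields one
   for each [j] by [twisted_exists]. *)
have [f1e f1T] : is_f1 dia alpha a e f11 f1.
  rewrite /f1 /f1_map; apply: xgetPex.
  have /choice[phi phiP] : forall j, exists phi,
      twisted L dia c (a j) phi /\ forall i, phi (e i) = f11 j i.
    move=> j.
    have [i|phi] := twisted_exists (d_ge2 := d_ge2) act (gamma := gamma)
                      (w := a j) (x := f11 j).
      by apply/eqP; rewrite -subr_eq0; apply/eqP/Ha.
    by exists phi.
  by exists phi; split=> j; case: (phiP j).
pose g j : tp_monoid act c := TwistedPair (f1T j : twisted L dia c (a j) (f1 j)).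
(* As the adjoint group is abelian, both products lie over the same element, so it suffices to
   compare them on the basis, where condition (b) applies. *)
have cgg i j : commute (g i) (g j).
  apply: tp_eq; first by apply: (centsP abL); rewrite inE.
  have Tij : twisted L dia c (a i * a j)%g (tp_map (g i * g j)%g) := tp_mapP _.
  have Tji : twisted L dia c (a i * a j)%g (tp_map (g j * g i)%g).
    by rewrite (centsP abL (a i) _ (a j)) ?inE; first exact: (tp_mapP (g j * g i)%g).
  exact: (twisted_ext Tij Tji (fun k => Hb k i j)).
have gr j : (g j ^+ #[a j] = 1)%g.
  have baseX : tp_base (g j ^+ #[a j])%g = 1%g by rewrite tp_baseX expg_order.
  apply: tp_eq => //.
  have := tp_mapP (g j ^+ #[a j])%g; rewrite baseX => TX.
  apply: (twisted_ext TX (twisted1 act c)) => i.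
  rewrite tp_mapX /= expg_order lcs_op1 -[RHS](Hc i j).
  (* The product of [a j] and [a j ^+ l] is by definition [a j + lcs_inv L (a j) (a j ^+ l)]. *)
  have abarE l : abar a j l = lcs_inv L (a j) (a j ^+ l)%g.
    by rewrite /abar expgS [X in X - _]addrC addrK.
  by congr (_ + _ - _); apply: eq_bigr => l _; rewrite abarE.
have [p [p1 pa pM]] :=
  bigdprod_cycle_lift (G := [group of [set: adjoint L]]) dirL cgg gr.
(* The recursion defining [magma_f] is the product of twisted pairs, so its value depends only on
   the element that the word represents. *)
have pw w : tp_base (p (magma_eval a w)) = magma_eval a w /\
    tp_map (p (magma_eval a w)) = magma_f dia prec alpha a f1 w.
  elim: w => [j|v [bv mv] w [bw mw]] /=; first by rewrite pa.
  by rewrite pM ?inE //= bv bw mv mw.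
have fE h : tp_base (p h) = h /\ f h =1 tp_map (p h).
  have f_word v : f (magma_eval a v) =1 tp_map (p (magma_eval a v)).
    move=> x; apply: xget_unique; first by exists v => //; rewrite (pw v).2.
    by move=> _ [w <- <-]; rewrite (pw w).2.
  have [->|[w <-]] := dprod_cycle_magma_eval dirL h; last by split; [case: (pw w)|].
  rewrite p1; split=> // x.
  (* At the identity, either a word exists and gives the zero map of [p 1], or the default 0 of
     [induced_f] gives the same value. *)
  have [[w w1]|no] := pselect (exists w, magma_eval a w = 1%g).
    by rewrite -w1 f_word w1 p1.
  by apply: xgetPN => y [w w1 _]; apply: no; exists w.
have fT h : twisted L dia c h (tp_map (p h)).
  by rewrite -[X in twisted _ _ _ X](fE h).1; exact: tp_mapP.
rewrite /is_2cocycle; split=> [h|h l m|h l m]; rewrite !opprK.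
- by rewrite !(fE _).2 (twisted0 act (fT h)) [X in tp_map X](p1 : p 0 = _).
- by rewrite !(fE _).2 fT.
(* With [h + l] written as the product of [h] and [L h l], the second cocycle equation is the
   multiplicativity of [p]. *)
rewrite !(fE _).2 -[in LHS](lcs_mulE L h l) pM ?inE //.
transitivity (mul_step dia prec c (h : adjoint L) (L h l)
  (tp_map (p h)) (tp_map (p (L h l))) m).
  by rewrite /= !(fE _).1.
exact: mul_step_op.
Qed.
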